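(* For $\theta\in[0,2\pi)$, denote by $B_\theta$ the solution of the optimization problem $$(\mathrm{Rot}_\theta)\qquad B_\theta=\operatorname*{argmin}_{B\in M(\mathbb{Z},2)}\ \int_0^{2\pi}\left\|(R_\theta-B)\begin{pmatrix}\cos t\\ \sin t\end{pmatrix}\right\|_2^2\,dt\qquad\text{subject to }\det(B)=1 .$$ Then $B_\theta$ equals - $I$ for $2\pi-\arcsin(\frac12)\le\theta<\arcsin(\frac12)$ (understood modulo $2\pi$, i.e. $0\le\theta<\arcsin(\frac12)$ or $2\pi-\arcsin(\frac12)\le\theta<2\pi$); - $S_{-1}$ or $S_1^T$ for $\arcsin(\frac12)\le\theta<\frac{\pi}{4}$; - $S_1^{(1)}$ or $S_1^{(2)}$ for $\frac{\pi}{4}<\theta\le\arccos(\frac12)$; - $S_0^{(1)}$ for $\arccos(\frac12)<\theta\le\pi-\arccos(\frac12)$; - $S_{-1}^{(1)}$ or $S_{-1}^{(2)}$ for $\pi-\arccos(\frac12)<\theta\le\frac{3\pi}{4}$; - $-S_1$ or $-S_{-1}^T$ for $\frac{3\pi}{4}<\theta\le\pi-\arcsin(\frac12)$. The remaining six cases can be determined by transposition of the previous matrices; in particular, $B_\theta$ equals - $-I$ for $\pi-\arcsin(\frac12)<\theta\le\pi+\arcsin(\frac12)$; - $-S_1^T$ or $-S_{-1}$ for $\pi+\arcsin(\frac12)<\theta\le\frac{5\pi}{4}$; - $(S_{-1}^{(1)})^T$ or $(S_{-1}^{(2)})^T$ for $\frac{5\pi}{4}<\theta\le\pi+\arccos(\frac12)$;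 - $(S_0^{(1)})^T$ for $\pi+\arccos(\frac12)<\theta\le\frac{3\pi}{2}+\arcsin(\frac12)$; - $(S_1^{(1)})^T$ or $(S_1^{(2)})^T$ for $\frac{3\pi}{2}+\arcsin(\frac12)<\theta\le\frac{7\pi}{4}$; - $S_{-1}^T$ or $S_1$ for $\frac{7\pi}{4}\le\theta<2\pi-\arcsin(\frac12)$.
   Context: $M(\mathbb{Z},2)$ is the set of $2\times2$ integer matrices, $I$ is the $2\times2$ identity matrix, $\|\cdot\|_2$ is the Euclidean norm on $\mathbb{R}^2$, and $R_\theta=\begin{pmatrix}\cos\theta&-\sin\theta\\ \sin\theta&\cos\theta\end{pmatrix}$ is the planar rotation by $\theta$ radians. For $s\in\mathbb{R}$ (only $s\in\{-1,0,1\}$ is used), $$S_s=\begin{pmatrix}1&s\\0&1\end{pmatrix},\qquad S_s^{(1)}=\begin{pmatrix}s&-1\\1&0\end{pmatrix},\qquad S_s^{(2)}=\begin{pmatrix}0&-1\\1&s\end{pmatrix}.$$ The superscript $T$ denotes the transpose.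
   Formalization: At the twelve angles where cases meet (e.g. θ = arcsin(1/2), where I also attains the minimum) the solution is not confined to the listed matrices; there only ''each listed matrix is a solution'' is proved, while at all other angles the listed matrices are exactly the solutions. *)

(* Defs.v *)
From HB Require Import structures.
From mathcomp Require Export all_boot all_order all_algebra.
From mathcomp Require Export all_classical all_reals all_analysis.

Set Implicit Arguments.
Unset Strict Implicit.
Unset Printing Implicit Defensive.

Import Order.TTheory GRing.Theory Num.Theory.
Local Open Scope classical_set_scope.
Local Open Scope ring_scope.

Definition mx2 (K : Type) (a b c d : K) : 'M[K]_2 :=
  \matrix_(i, j) if i == 0 then (if j == 0 then a else b)
                 else (if j == 0 then c else d).

Definition rotation (R : realType) (theta : R) : 'M[R]_2 :=
  mx2 (cos theta) (- sin theta) (sin theta) (cos theta).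

Definition Smx (K : pzRingType) (s : K) : 'M[K]_2 := mx2 1 s 0 1.
Definition Smx1 (K : pzRingType) (s : K) : 'M[K]_2 := mx2 s (-1) 1 0.
Definition Smx2 (K : pzRingType) (s : K) : 'M[K]_2 := mx2 0 (-1) 1 s.

(* The library norm on matrices is the maximum norm. *)
Definition norm2 (R : realType) (n : nat) (v : 'cV[R]_n) : R :=
  Num.sqrt (\sum_(i < n) v i 0 ^+ 2).

Definition circle_pt (R : realType) (t : R) : 'cV[R]_2 :=
  \col_i if i == 0 then cos t else sin t.

Definition Rot_cost (R : realType) (theta : R) (B : 'M[int]_2) : R :=
  \int[lebesgue_measure]_(t in `[0, 2 * pi])
    norm2 ((rotation theta - map_mx intr B) *m circle_pt t) ^+ 2.

Definition Rot_argmin (R : realType) (theta : R) : set 'M[int]_2 :=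
  [set B | \det B = 1 /\
           forall C : 'M[int]_2, \det C = 1 -> Rot_cost theta B <= Rot_cost theta C].

Definition switching_angles (R : realType) : seq R :=
  [:: asin 2^-1; pi / 4; acos 2^-1; pi - acos 2^-1; 3 * pi / 4; pi - asin 2^-1;
      pi + asin 2^-1; 5 * pi / 4; pi + acos 2^-1; 3 * pi / 2 + asin 2^-1;
      7 * pi / 4; 2 * pi - asin 2^-1].

(* "B_theta equals one of the members of s": every member of s solves the
   problem, and there are no other solutions.  At a switching angle the optimal
   families on both sides tie, so there the second part cannot be required. *)
Definition Rot_solved_by (R : realType) (theta : R) (s : seq 'M[int]_2) : Prop :=
  [set` s] `<=` Rot_argmin theta /\
  (theta \notin switching_angles R -> Rot_argmin theta = [set` s]).

(* Main.v *)
From mathcomp Require Import ring lra zify.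
Require Import Defs.
Set Implicit Arguments.
Unset Strict Implicit.
Import Order.TTheory GRing.Theory Num.Theory.
Import numFieldNormedType.Exports.
Local Open Scope classical_set_scope.
Local Open Scope ring_scope.

(** Integrating over the circle turns the cost into pi times the squared
    Frobenius distance from [R_theta] to [B].  Put [p = tr B] and let [q] be the
    (2,1) entry minus the (1,2) entry.  When [det B = 1], [|B|^2 = p^2 + q^2 - 2],
    so the cost is [pi (|(p, q) - (cos theta, sin theta)|^2 - 1)], and
    [p^2 + q^2 - 4 = (b11 - b22)^2 + (b12 + b21)^2 >= 0].  One is thus looking for
    the admissible integer vector nearest to a point of the unit circle; those of
    norm at least [sqrt 6] are always too far, and twelve shorter ones remain:
    [(+-2, 0)], [(0, +-2)], [(+-2, +-1)] and [(+-1, +-2)].  Comparing them gives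
    linear inequalities in [cos theta] and [sin theta], and the quarter turns and
    the reflection in the first axis reduce all cases to [(2, 0)] and [(2, 1)]. *)

(** * The cost integral over the circle *)

Section integral.
Context {R : realType}.
Implicit Types a b c d : R.

Lemma integral_circle_quadratic a b c d :
  \int[lebesgue_measure]_(t in `[0, 2 * pi])
    ((a * cos t + b * sin t) ^+ 2 + (c * cos t + d * sin t) ^+ 2) =
  pi * (a ^+ 2 + b ^+ 2 + c ^+ 2 + d ^+ 2) :> R.
Proof.
set f := fun t : R => (a * cos t + b * sin t) ^+ 2 + (c * cos t + d * sin t) ^+ 2.
(* Antiderivatives of [cos ^+ 2], [2 * sin * cos] and [sin ^+ 2], weighted by the coefficients of
   the expanded squares. *)
pose F := fun t : R => (a ^+ 2 + c ^+ 2) / 2 * (t + sin t * cos t)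
  + (a * b + c * d) * sin t ^+ 2 + (b ^+ 2 + d ^+ 2) / 2 * (t - sin t * cos t).
have dF (t : R) : is_derive t (1 : R) F (f t).
  rewrite /F; apply: is_derive_eq.
  rewrite /f /GRing.scale /=; have := sin2cos2 t.
  by set x := cos t; set y := sin t => xy; field: xy.
have cF : continuous F.
  by move=> t; apply/differentiable_continuous/derivable1_diffP; case: (dF t).
have cf : continuous f.
  move=> t; apply/differentiable_continuous/derivable1_diffP.
  by rewrite /f; exact: ex_derive.
rewrite /Rintegral (@continuous_FTC2 _ f F) //.
- by rewrite /F cos0 sin0 mulr_natl sin2pi cos2pi /=; field.
- by rewrite mulr_gt0 ?pi_gt0.
- exact: continuous_subspaceT.
- split; first by move=> t _; case: (dF t).
  + exact/cvg_at_right_filter/cF.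
  + exact/cvg_at_left_filter/cF.
- by move=> t _; rewrite derive1E; case: (dF t).
Qed.
End integral.

(** * Two-by-two matrices by entries *)

Lemma sum_ord2 (V : nmodType) (F : 'I_2 -> V) : \sum_i F i = F 0 + F 1.
Proof. by rewrite !big_ord_recl big_ord0 addr0; congr (_ + F _); exact/val_inj. Qed.

Lemma det_mx22 (K : comPzRingType) (B : 'M[K]_2) :
  \det B = B 0 0 * B 1 1 - B 0 1 * B 1 0.
Proof.
rewrite (expand_det_row _ 0) sum_ord2 /cofactor !det_mx11 !mxE.
rewrite /= !expr0 !mul1r.
have -> : lift 0 ord0 = 1 :> 'I_2 by exact/val_inj.
have -> : lift 1 ord0 = 0 :> 'I_2 by exact/val_inj.
by rewrite expr1 mulN1r mulrN.
Qed.

Lemma mxtrace22 (K : nmodType) (B : 'M[K]_2) : \tr B = B 0 0 + B 1 1.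
Proof. exact: sum_ord2. Qed.

Lemma mx2E (K : Type) (B : 'M[K]_2) : B = mx2 (B 0 0) (B 0 1) (B 1 0) (B 1 1).
Proof.
apply/matrixP => i j; rewrite mxE.
by case: i => [[|[]]] // ?; case: j => [[|[]]] // ?; congr (B _ _); exact/val_inj.
Qed.

Lemma eq_mx2 (K : eqType) (a b c d a' b' c' d' : K) :
  (mx2 a b c d == mx2 a' b' c' d') = [&& a == a', b == b', c == c' & d == d'].
Proof.
apply/eqP/and4P => [/matrixP e|[/eqP-> /eqP-> /eqP-> /eqP->]//].
by have := (e 0 0, e 0 1, e 1 0, e 1 1); rewrite !mxE /= => -[[[-> ->] ->] ->].
Qed.

Lemma mx2N (K : zmodType) (a b c d : K) : - mx2 a b c d = mx2 (- a) (- b) (- c) (- d).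
Proof. by rewrite [LHS]mx2E !mxE. Qed.

Lemma trmx2 (K : Type) (a b c d : K) : (mx2 a b c d)^T = mx2 a c b d.
Proof. by rewrite [LHS]mx2E !mxE. Qed.

Lemma mx2_1 (K : pzRingType) : 1%:M = mx2 1 0 0 1 :> 'M[K]_2.
Proof. by rewrite [LHS]mx2E !mxE. Qed.

(** * Short vectors and the matrices above them *)

Definition skew (B : 'M[int]_2) : int := B 1 0 - B 0 1.

Definition short (p q : int) := 4 <= p ^+ 2 + q ^+ 2 < 6.

(** Listed counterclockwise, one for each arc of angles. *)
Definition short_vectors : seq (int * int) :=
  [:: (2, 0); (2, 1); (1, 2); (0, 2); (-1, 2); (-2, 1);
      (-2, 0); (-2, -1); (-1, -2); (0, -2); (1, -2); (2, -1)].

Lemma mem_short_vectors p q : ((p, q) \in short_vectors) = short p q.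
Proof.
apply/idP/idP.
  rewrite !inE !xpair_eqE.
  by do 11?[case/orP]; case/andP=> /eqP-> /eqP->.
rewrite /short => h.
have hp : -2 <= p <= 2 by nia.
have hq : -2 <= q <= 2 by nia.
rewrite !inE !xpair_eqE /=.
have hp' : p = -2 \/ p = -1 \/ p = 0 \/ p = 1 \/ p = 2 by lia.
have hq' : q = -2 \/ q = -1 \/ q = 0 \/ q = 1 \/ q = 2 by lia.
by case: hp' h => [|[|[|[|]]]] ->; case: hq' => [|[|[|[|]]]] ->.
Qed.

(** For any [B], the left side minus the two squares on the right is [4 * \det B]. *)
Lemma sqr_tr_skew (B : 'M[int]_2) : \det B = 1 ->
  \tr B ^+ 2 + skew B ^+ 2 = 4 + (B 0 0 - B 1 1) ^+ 2 + (B 0 1 + B 1 0) ^+ 2.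
Proof.
rewrite det_mx22 mxtrace22 /skew.
move: (B 0 0) (B 0 1) (B 1 0) (B 1 1) => a b c d; nia.
Qed.

(** Matrices of determinant 1 with the same trace and skew part have the same cost, so each answer
    list is such a whole fiber. *)
Definition mx_fiber (p q : int) (s : seq 'M[int]_2) :=
  forall B, (B \in s) = [&& \det B == 1, \tr B == p & skew B == q].

(** Shortness leaves at most 1 for [(a - d) ^+ 2 + (b + c) ^+ 2], so at most one of these integers
    is nonzero, and it is then 1 or -1. This turns the quadratic condition into a piecewise linear
    one. *)
Lemma mx_fiberP p q s : short p q ->
  (forall a b c d : int, mx2 a b c d \in s ->
     [/\ a * d - b * c = 1, a + d = p & c - b = q]) ->
  (forall a b c d : int, a + d = p -> c - b = q ->
     `|a - d| + `|b + c| <= 1 -> mx2 a b c d \in s) ->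
  mx_fiber p q s.
Proof.
move=> pq sP Ps B; rewrite [in LHS](mx2E B) det_mx22 mxtrace22 /skew.
move: (B 0 0) (B 0 1) (B 1 0) (B 1 1) => a b c d.
apply/idP/idP => [/sP[-> -> ->]|]; first by rewrite !eqxx.
move=> /and3P[/eqP e1 /eqP e2 /eqP e3]; apply: Ps => //.
have le1 : (a - d) ^+ 2 + (b + c) ^+ 2 <= 1 by move: pq; rewrite /short -e2 -e3; nia.
have ? : -1 <= a - d <= 1 by nia.
have ? : -1 <= b + c <= 1 by nia.
have ? : (a - d) * (b + c) = 0 by nia.
nia.
Qed.

Ltac decide_fiber :=
  apply: mx_fiberP => // a b c d;
  rewrite !inE /Smx /Smx1 /Smx2 ?mx2_1 ?trmx2 ?mx2N ?trmx2 !eq_mx2;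
  [by do ?[case/orP]; case/and4P=> /eqP-> /eqP-> /eqP-> /eqP-> | lia].

(** * Gaps and nearest short vectors *)

Section nearest.
Context {R : realType}.
Implicit Types (x y theta : R) (p q : int) (b : bool).

(* For [(x, y)] on the unit circle this is [|(p, q) - (x, y)|^2 - 1]. *)
Definition gap x y p q : R :=
  (p ^+ 2 + q ^+ 2)%:~R - 2 * (p%:~R * x + q%:~R * y).

Lemma gapNx x y p q : gap (- x) y p q = gap x y (- p) q.
Proof. by rewrite /gap sqrrN mulrNz mulNr mulrN. Qed.

Lemma gapNy x y p q : gap x (- y) p q = gap x y p (- q).
Proof. by rewrite /gap sqrrN mulrNz mulNr mulrN. Qed.

Lemma gapC x y p q : gap y x p q = gap x y q p.
Proof. by rewrite /gap (addrC (p ^+ 2)) (addrC (p%:~R * y)). Qed.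

(** The bound is [(1 - 2 / 5) * 6 - 5 / 2], just below the Cauchy-Schwarz value [6 - 2 * sqrt 6]. *)
Lemma long_gap x y p q : x ^+ 2 + y ^+ 2 = 1 -> 6 <= p ^+ 2 + q ^+ 2 ->
  11 / 10 <= gap x y p q.
Proof.
move=> xy; rewrite -(ler_int R) /gap !rmorphD !rmorphXn /=.
move: p%:~R q%:~R => {}p {}q pq.
(* AM-GM: [2 (p x + q y) <= k + (p^2 + q^2) / k] with [k = 5 / 2]. *)
have := sqr_ge0 (5 / 2 * x - p); have := sqr_ge0 (5 / 2 * y - q).
by nra.
Qed.

Lemma short_gap_lt x y (m : R) : x ^+ 2 + y ^+ 2 = 1 ->
  (forall p q, short p q -> m <= gap x y p q) -> m < 11 / 10.
Proof.
move=> xy le_m; rewrite ltNge; apply/negP => m_ge.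
have g p q : short p q -> 11 / 10 <= gap x y p q.
  by move=> /le_m; apply: le_trans.
(* Sign changes permute the short vectors, so the first quadrant suffices. *)
wlog x0 : x xy {le_m} g / 0 <= x => [wl|].
  have [/wl|x0] := leP 0 x; first exact.
  apply: (wl (- x)); rewrite ?sqrrN ?oppr_ge0 ?ltW // => p q pq.
  by rewrite gapNx; apply: g; rewrite /short sqrrN.
wlog y0 : y xy g / 0 <= y => [wl|].
  have [/wl|y0] := leP 0 y; first exact.
  apply: (wl (- y)); rewrite ?sqrrN ?oppr_ge0 ?ltW // => p q pq.
  by rewrite gapNy; apply: g; rewrite /short sqrrN.
(* These give [x, y <= 29 / 40] and, adding the last two, [x + y <= 13 / 10]; then
   [x ^+ 2 + y ^+ 2 < 1]. *)
have := (g 2 0 isT, g 0 2 isT, g 1 2 isT, g 2 1 isT).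
rewrite /gap => -[[[]]] /= h1 h2 h3 h4.
nra.
Qed.

(** A short vector has a coordinate 2 or -2; written [2 * e], it yields an explicit matrix with
    determinant [e ^+ 2]. *)
Lemma short_attained p q : short p q ->
  exists B : 'M[int]_2, [/\ \det B = 1, \tr B = p & skew B = q].
Proof.
move=> pq.
suff E e : e ^+ 2 = 1 -> p = 2 * e \/ q = 2 * e ->
    exists B : 'M[int]_2, [/\ \det B = 1, \tr B = p & skew B = q].
  have [h|h] : (p = 2 \/ q = 2) \/ (p = -2 \/ q = -2) by move: pq; rewrite /short; nia.
    exact: (E 1).
  exact: (E (-1)).
move=> e1 [->|->].
- by exists (mx2 e 0 q e); rewrite det_mx22 mxtrace22 /skew !mxE /=; split; lia.
- by exists (mx2 p (- e) e 0); rewrite det_mx22 mxtrace22 /skew !mxE /=; split; lia.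
Qed.

(* Ties with other vectors are allowed exactly when [b = true]. *)
Definition nearest b x y p q := short p q /\
  forall p' q', short p' q' -> (p', q') != (p, q) ->
    gap x y p q < gap x y p' q' ?<= if b.

Lemma nearestNy b x y p q : nearest b x (- y) p (- q) -> nearest b x y p q.
Proof.
case; rewrite /short sqrrN => pq h; split=> // p' q' pq' ne.
have := h p' (- q'); rewrite !gapNy !opprK; apply; first by rewrite /short sqrrN.
by rewrite xpair_eqE eqr_opp.
Qed.

Lemma nearestC b x y p q : nearest b y x q p -> nearest b x y p q.
Proof.
case; rewrite /short addrC => pq h; split=> // p' q' pq' ne.
have := h q' p'; rewrite !(gapC x); apply; first by rewrite /short addrC.
by rewrite xpair_eqE andbC -xpair_eqE.
Qed.

(** The rivals [(2, 1)] and [(2, -1)] lose by [1 - 2 * y] and [1 + 2 * y]. The bound on [x] beats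
    [(1, 2)] and [(1, -2)] strictly. *)
Lemma nearest_axis b x y : 2^-1 < x -> - 2^-1 < y ?<= if b -> y < 2^-1 ?<= if b ->
  nearest b x y 2 0.
Proof.
move=> hx h1 h2; split=> // p q; rewrite -mem_short_vectors !inE.
do 11?[case/predU1P=> [[-> ->]|]] => //; last move=> /eqP[-> ->].
all: move=> _; rewrite /gap; case: b h1 h2 => /= h1 h2; lra.
Qed.

(** The rivals [(2, 0)] and [(1, 2)] lose by [2 * y - 1] and [2 * (x - y)]. *)
Lemma nearest_diag b x y : 2^-1 < y ?<= if b -> y < x ?<= if b -> nearest b x y 2 1.
Proof.
move=> h1 h2; split=> // p q; rewrite -mem_short_vectors !inE.
do 11?[case/predU1P=> [[-> ->]|]] => //; last move=> /eqP[-> ->].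
all: move=> _; rewrite /gap; case: b h1 h2 => /= h1 h2; lra.
Qed.

(** * From coordinates to angles *)

Lemma asin_half_bounds : - (pi / 2) <= asin (2^-1 : R) <= pi / 2.
Proof. by rewrite asin_geNpi2 ?asin_lepi2 //; lra. Qed.

Lemma sin_asin_half : sin (asin 2^-1) = 2^-1 :> R.
Proof. by rewrite asinK // in_itv /=; lra. Qed.

(** Writes all switching angles in terms of [pi] and [asin 2^-1], making their comparisons
    linear. *)
Lemma acos_half : acos 2^-1 = pi / 2 - asin 2^-1 :> R.
Proof.
apply: cos_inj.
- by rewrite in_itv /= acos_ge0 ?acos_lepi //; lra.
- by have := asin_half_bounds; rewrite in_itv /=; lra.
- by rewrite acosK ?in_itv /= ?cosB ?cos_pihalf ?sin_pihalf ?sin_asin_half; lra.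
Qed.

Lemma lteif_sin b (s t : R) : - (pi / 2) <= s -> s < t ?<= if b -> t <= pi / 2 ->
  sin s < sin t ?<= if b.
Proof.
move=> hs st ht; have st' := lteifW st.
have [s_in t_in] : s \in `[- (pi / 2), pi / 2] /\ t \in `[- (pi / 2), pi / 2].
  by rewrite !in_itv /=; split; lra.
case: b st => /= [|?]; last by rewrite ltr_sin.
by rewrite le_eqVlt => /predU1P[->//|?]; rewrite ltW // ltr_sin.
Qed.

Lemma asin_half_gt0 : 0 < asin (2^-1 : R).
Proof.
have /andP[? ?] := asin_half_bounds; rewrite ltNge; apply/negP => le0.
suff : sin (asin (2^-1 : R)) <= sin 0 by rewrite sin_asin_half sin0; lra.
by apply: (@lteif_sin true) => //=; lra.
Qed.

Lemma nearest_angle_axis b theta :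
  - asin 2^-1 < theta ?<= if b -> theta < asin 2^-1 ?<= if b ->
  nearest b (cos theta) (sin theta) 2 0.
Proof.
have /andP[a0 a1] := asin_half_bounds => h1 h2.
have h1' := lteifW h1; have h2' := lteifW h2.
have s2 : sin theta < 2^-1 ?<= if b by rewrite -sin_asin_half lteif_sin //; lra.
have s1 : - 2^-1 < sin theta ?<= if b.
  by rewrite -sin_asin_half -sinN lteif_sin //; lra.
apply: nearest_axis => //.
(* The cosine is nonnegative with square at least 3/4, hence exceeds 1/2. *)
have c0 : 0 <= cos theta by apply: cos_ge0_pihalf; lra.
have := cos2Dsin2 theta.
have := lteifW s1; have := lteifW s2.
nra.
Qed.

Lemma nearest_angle_diag b theta :
  asin 2^-1 < theta ?<= if b -> theta < pi / 4 ?<= if b ->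
  nearest b (cos theta) (sin theta) 2 1.
Proof.
have /andP[a0 a1] := asin_half_bounds; have a2 := asin_half_gt0 => h1 h2.
have h1' := lteifW h1; have h2' := lteifW h2; have p0 := pi_gt0 R.
apply: nearest_diag; first by rewrite -sin_asin_half lteif_sin //; lra.
have -> : cos theta = sin (pi / 2 - theta).
  by rewrite sinB sin_pihalf cos_pihalf mul1r mul0r subr0.
rewrite lteif_sin //; [lra| |lra].
by case: b h1 h2 => /= _ ?; lra.
Qed.

(** A quarter turn clockwise takes [(p, q)] to [(q, - p)]; it is a swap of coordinates followed by a
    reflection. *)
Lemma nearest_rotate b theta p q :
  nearest b (cos (theta - pi / 2)) (sin (theta - pi / 2)) q (- p) ->
  nearest b (cos theta) (sin theta) p q.
Proof. by rewrite cosBpihalf sinBpihalf => /nearestNy/nearestC. Qed.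

Lemma nearest_reflect b theta p q :
  nearest b (cos (- theta)) (sin (- theta)) p (- q) ->
  nearest b (cos theta) (sin theta) p q.
Proof. by rewrite cosN sinN => /nearestNy. Qed.

(** * Reduction of the problem to gaps *)

Lemma norm2_sqr (v : 'cV[R]_2) : norm2 v ^+ 2 = v 0 0 ^+ 2 + v 1 0 ^+ 2.
Proof.
rewrite /norm2 sqr_sqrtr ?sumr_ge0 // => [|i _]; last exact: sqr_ge0.
exact: sum_ord2.
Qed.

Lemma Rot_costE theta (B : 'M[int]_2) : \det B = 1 ->
  Rot_cost theta B = pi * gap (cos theta) (sin theta) (\tr B) (skew B).
Proof.
move=> dB; rewrite /Rot_cost.
transitivity (\int[lebesgue_measure]_(t in `[0, 2 * pi])
  (((cos theta - (B 0 0)%:~R) * cos t + (- sin theta - (B 0 1)%:~R) * sin t) ^+ 2 +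
   ((sin theta - (B 1 0)%:~R) * cos t + (cos theta - (B 1 1)%:~R) * sin t) ^+ 2) : R).
  by apply: eq_Rintegral => t _; rewrite norm2_sqr !mxE !sum_ord2 !mxE.
rewrite integral_circle_quadratic; congr (_ * _).
(* The rotation has squared Frobenius norm 2, which cancels the -2 in the formula for [B]. *)
move: dB; rewrite det_mx22 mxtrace22 /skew /gap => /(congr1 (intr : int -> R)).
rewrite !(rmorphD, rmorphN, rmorphM, rmorphXn, rmorph1) /=.
have := sin2cos2 theta.
move: (cos _) (sin _) (B 0 0)%:~R (B 0 1)%:~R (B 1 0)%:~R (B 1 1)%:~R => x y a c d e.
by move=> xy; lra.
Qed.

Lemma Rot_argminE theta (B : 'M[int]_2) : Rot_argmin theta B <->
  \det B = 1 /\ forall C : 'M[int]_2, \det C = 1 ->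
    gap (cos theta) (sin theta) (\tr B) (skew B) <=
    gap (cos theta) (sin theta) (\tr C) (skew C).
Proof.
have leE (C : 'M[int]_2) : \det B = 1 -> \det C = 1 ->
    (Rot_cost theta B <= Rot_cost theta C) =
    (gap (cos theta) (sin theta) (\tr B) (skew B) <=
     gap (cos theta) (sin theta) (\tr C) (skew C)).
  by move=> dB dC; rewrite (Rot_costE theta dB) (Rot_costE theta dC) ler_pM2l ?pi_gt0.
split=> -[dB h]; split; first exact: dB.
- by move=> C dC; rewrite -leE; [exact: h|exact: dB|exact: dC].
- exact: dB.
- by move=> C dC; rewrite leE; [exact: h|exact: dB|exact: dC].
Qed.

Lemma short_or_long (B : 'M[int]_2) : \det B = 1 ->
  short (\tr B) (skew B) \/ 6 <= \tr B ^+ 2 + skew B ^+ 2.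
Proof.
move=> /sqr_tr_skew; rewrite /short => ->.
by move: (B 0 0 - _) (B 0 1 + _) => r u; nia.
Qed.

(** A gap not above any short gap is below 11/10, while long vectors have gap at least 11/10. *)
Lemma Rot_argmin_short theta (B : 'M[int]_2) : \det B = 1 ->
  (forall p q, short p q ->
    gap (cos theta) (sin theta) (\tr B) (skew B) <= gap (cos theta) (sin theta) p q) ->
  Rot_argmin theta B.
Proof.
move=> dB h; apply/Rot_argminE; split=> // C /short_or_long[/h //|long].
apply: (le_trans _ (long_gap (cos2Dsin2 theta) long)).
exact/ltW/(short_gap_lt (cos2Dsin2 theta)).
Qed.

Lemma Rot_argmin_nonempty theta : Rot_argmin theta !=set0.
Proof.
pose v (i : 'I_(size short_vectors)) := nth (0, 0) short_vectors i.
pose g pq := gap (cos theta) (sin theta) pq.1 pq.2.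
have vP i : short (v i).1 (v i).2.
  by rewrite -mem_short_vectors -surjective_pairing mem_nth.
have [i _ le_i] := arg_minP (P := xpredT) (g \o v) (i0 := ord0) isT.
have [B [dB tB kB]] := short_attained (vP i).
exists B; apply: Rot_argmin_short => // p q; rewrite -mem_short_vectors => pq.
have lt_pq : (index (p, q) short_vectors < size short_vectors)%N by rewrite index_mem.
by have := le_i (Ordinal lt_pq) isT; rewrite /= /g /v /= nth_index // tB kB.
Qed.

Lemma Rot_solved_by_nearest theta p q s : mx_fiber p q s ->
  nearest true (cos theta) (sin theta) p q ->
  (theta \notin switching_angles R -> nearest false (cos theta) (sin theta) p q) ->
  Rot_solved_by theta s.
Proof.
move=> sE [pq le_pq] lt_pq; have sub : [set` s] `<=` Rot_argmin theta.
  move=> B /=; rewrite sE => /and3P[/eqP dB /eqP tB /eqP kB].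
  apply: Rot_argmin_short => // p' q' pq'; rewrite tB kB.
  by have [[-> ->]//|/le_pq] := eqVneq (p', q') (p, q); apply.
split=> // /lt_pq[_ {}lt_pq]; apply/seteqP; split=> // B /Rot_argminE[dB le_B].
have [B0 [dB0 tB0 kB0]] := short_attained pq.
have := le_B _ dB0; rewrite tB0 kB0 => {}le_B.
(* A minimiser outside the fiber would have either another short vector, which is strictly worse, or
   a long one, whose gap is too large. *)
rewrite /= sE dB eqxx -xpair_eqE; apply/negPn/negP => ne.
have [sB|/(long_gap (cos2Dsin2 theta)) lB] := short_or_long dB.
  by have /= := lt_pq _ _ sB ne; rewrite ltNge le_B.
suff : gap (cos theta) (sin theta) p q < 11 / 10 by lra.
apply: (short_gap_lt (cos2Dsin2 theta)) => p' q' pq'.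
by have [[-> ->]//|/le_pq] := eqVneq (p', q') (p, q); apply.
Qed.

(** Optimality uses [near] with [b = true] on the closed arc, uniqueness uses [b = false] on the
    open one. *)
Lemma Rot_solved_by_itv theta lo hi p q s : mx_fiber p q s ->
  lo <= theta <= hi ->
  (theta \notin switching_angles R -> (lo != theta) && (theta != hi)) ->
  (forall b, lo < theta ?<= if b -> theta < hi ?<= if b ->
    nearest b (cos theta) (sin theta) p q) ->
  Rot_solved_by theta s.
Proof.
move=> sE /andP[lo_t t_hi] ne near; apply: (Rot_solved_by_nearest sE).
  exact: (near true).
by move=> /ne/andP[? ?]; apply: (near false); rewrite /= lt_neqAle ?lo_t ?t_hi ?andbT.
Qed.

(** Transposition keeps the trace and negates [skew], just as the change of angle keeps the cosine
    and negates the sine. *)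
Lemma Rot_argmin_tr theta (B : 'M[int]_2) :
  Rot_argmin (2 * pi - theta) B^T <-> Rot_argmin theta B.
Proof.
have c : cos (2 * pi - theta) = cos theta.
  by rewrite mulr_natl addrC cosD2pi cosN.
have k : sin (2 * pi - theta) = - sin theta.
  by rewrite mulr_natl addrC sinD2pi sinN.
have kT (C : 'M[int]_2) : skew C^T = - skew C by rewrite /skew !mxE opprB.
rewrite !Rot_argminE c k det_tr mxtrace_tr kT gapNy opprK.
split=> -[dB h]; split=> // C dC; have := h C^T;
  by rewrite det_tr mxtrace_tr kT !gapNy ?opprK; apply.
Qed.

End nearest.

(* Case analysis over the arcs *)
Tactic Notation "between" uconstr(lo) uconstr(hi) uconstr(p) uconstr(q) hyp(sw) :=
  refine (@Rot_solved_by_itv _ _ lo hi p q _ _ _ (sw _ _ _ _) _);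
  [by decide_fiber | lra | by rewrite !inE eqxx ?orbT | by rewrite !inE eqxx ?orbT |].

Ltac rotate := apply: nearest_rotate; rewrite ?opprK ?oppr0.
Ltac reflect := apply: nearest_reflect; rewrite ?opprK ?oppr0.
Ltac lteif_lra := case=> /= ? ?; lra.

Theorem theorem5p1 (R : realType) (theta : R) (htheta : 0 <= theta < 2 * pi) :
  Rot_argmin theta !=set0 /\
  (0 <= theta < asin 2^-1 \/ 2 * pi - asin 2^-1 <= theta < 2 * pi ->
     Rot_solved_by theta [:: 1%:M]) /\
  (asin 2^-1 <= theta < pi / 4 ->
     Rot_solved_by theta [:: Smx (-1); (Smx 1)^T]) /\
  (pi / 4 < theta <= acos 2^-1 ->
     Rot_solved_by theta [:: Smx1 1; Smx2 1]) /\
  (acos 2^-1 < theta <= pi - acos 2^-1 ->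
     Rot_solved_by theta [:: Smx1 0]) /\
  (pi - acos 2^-1 < theta <= 3 * pi / 4 ->
     Rot_solved_by theta [:: Smx1 (-1); Smx2 (-1)]) /\
  (3 * pi / 4 < theta <= pi - asin 2^-1 ->
     Rot_solved_by theta [:: - Smx 1; - (Smx (-1))^T]) /\
  (0 < theta -> forall B : 'M[int]_2,
     Rot_argmin (2 * pi - theta) B^T <-> Rot_argmin theta B) /\
  (pi - asin 2^-1 < theta <= pi + asin 2^-1 ->
     Rot_solved_by theta [:: - 1%:M]) /\
  (pi + asin 2^-1 < theta <= 5 * pi / 4 ->
     Rot_solved_by theta [:: - (Smx 1)^T; - Smx (-1)]) /\
  (5 * pi / 4 < theta <= pi + acos 2^-1 ->
     Rot_solved_by theta [:: (Smx1 (-1))^T; (Smx2 (-1))^T]) /\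
  (pi + acos 2^-1 < theta <= 3 * pi / 2 + asin 2^-1 ->
     Rot_solved_by theta [:: (Smx1 0)^T]) /\
  (3 * pi / 2 + asin 2^-1 < theta <= 7 * pi / 4 ->
     Rot_solved_by theta [:: (Smx1 1)^T; (Smx2 1)^T]) /\
  (7 * pi / 4 <= theta < 2 * pi - asin 2^-1 ->
     Rot_solved_by theta [:: (Smx (-1))^T; Smx 1]).
Proof.
have a0 := @asin_half_gt0 R; have /andP[_ a1] := @asin_half_bounds R.
have p0 := pi_gt0 R; have ac := @acos_half R.
have sw lo hi : lo \in switching_angles R -> hi \in switching_angles R ->
    theta \notin switching_angles R -> (lo != theta) && (theta != hi).
  move=> lo_sw hi_sw t_sw; apply/andP.
  by split; [apply: contraNneq t_sw => <-|apply: contraNneq t_sw => ->].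
split; first exact: Rot_argmin_nonempty.
split.
  case=> ?.
    (* The arc is extended to be symmetric about 0; [theta] lies strictly inside it. *)
    apply: (@Rot_solved_by_itv _ _ (- asin 2^-1) (asin 2^-1) 2 0).
    - by decide_fiber.
    - by lra.
    - by move=> _; rewrite !lt_eqF //; lra.
    - by move=> b; exact: nearest_angle_axis.
  apply: (@Rot_solved_by_itv _ _ (2 * pi - asin 2^-1) (2 * pi) 2 0).
  - by decide_fiber.
  - by lra.
  - have a_sw : 2 * pi - asin 2^-1 \in switching_angles R by rewrite !inE eqxx ?orbT.
    by case/(sw _ _ a_sw a_sw)/andP=> -> _; rewrite lt_eqF //; lra.
  (* Four quarter turns subtract [2 * pi] from the angle and fix the vector. *)
  - move=> b lo_t t_hi; do 4 rotate; apply: nearest_angle_axis; move: b lo_t t_hi; lteif_lra.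
split.
  move=> ?; between (asin 2^-1) (pi / 4) 2 1 sw.
  by move=> b lo_t t_hi; apply: nearest_angle_diag; move: b lo_t t_hi; lteif_lra.
split.
  move=> ?; between (pi / 4) (acos 2^-1) 1 2 sw.
  (* The vector goes from [(1, 2)] to [(2, -1)] to [(2, 1)], the angle to [pi / 2 - theta]. *)
  by move=> b lo_t t_hi; rotate; reflect; apply: nearest_angle_diag; move: b lo_t t_hi; lteif_lra.
split.
  move=> ?; between (acos 2^-1) (pi - acos 2^-1) 0 2 sw.
  by move=> b lo_t t_hi; rotate; apply: nearest_angle_axis; move: b lo_t t_hi; lteif_lra.
split.
  move=> ?; between (pi - acos 2^-1) (3 * pi / 4) (-1) 2 sw.
  by move=> b lo_t t_hi; rotate; apply: nearest_angle_diag; move: b lo_t t_hi; lteif_lra.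
split.
  move=> ?; between (3 * pi / 4) (pi - asin 2^-1) (-2) 1 sw.
  by move=> b lo_t t_hi; do 2 rotate; reflect; apply: nearest_angle_diag; move: b lo_t t_hi; lteif_lra.
split; first by move=> _ B; exact: Rot_argmin_tr.
split.
  move=> ?; between (pi - asin 2^-1) (pi + asin 2^-1) (-2) 0 sw.
  by move=> b lo_t t_hi; do 2 rotate; apply: nearest_angle_axis; move: b lo_t t_hi; lteif_lra.
split.
  move=> ?; between (pi + asin 2^-1) (5 * pi / 4) (-2) (-1) sw.
  by move=> b lo_t t_hi; do 2 rotate; apply: nearest_angle_diag; move: b lo_t t_hi; lteif_lra.
split.
  move=> ?; between (5 * pi / 4) (pi + acos 2^-1) (-1) (-2) sw.
  by move=> b lo_t t_hi; do 3 rotate; reflect; apply: nearest_angle_diag; move: b lo_t t_hi; lteif_lra.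
split.
  move=> ?; between (pi + acos 2^-1) (3 * pi / 2 + asin 2^-1) 0 (-2) sw.
  by move=> b lo_t t_hi; do 3 rotate; apply: nearest_angle_axis; move: b lo_t t_hi; lteif_lra.
split.
  move=> ?; between (3 * pi / 2 + asin 2^-1) (7 * pi / 4) 1 (-2) sw.
  by move=> b lo_t t_hi; do 3 rotate; apply: nearest_angle_diag; move: b lo_t t_hi; lteif_lra.
move=> ?; between (7 * pi / 4) (2 * pi - asin 2^-1) 2 (-1) sw.
by move=> b lo_t t_hi; do 4 rotate; reflect; apply: nearest_angle_diag; move: b lo_t t_hi; lteif_lra.
Qed.
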